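(* Let $\mathbb{H}$ be the quaternion algebra with its $(\Gamma,\lambda)$-commutative structure for $\Gamma=\{0,\tilde{\mathrm i},\tilde{\mathrm j},\tilde{\mathrm k}\}\le(\mathbb{Z}_2)^3$. For all $n\ge1$, all $\varsigma\in\mathfrak{S}(\lambda)$ and all $\boldsymbol{\nu}\in\Gamma^n$, the following diagram of groups commutes: $\Gamma\!\det_\varsigma:\mathsf{hGL}(\boldsymbol{\nu};\mathbb{H})\to\mathbb{H}_h^\times$ is a group morphism and $$\pi\circ\Gamma\!\det{}_\varsigma=\mathrm{Ddet}\quad\text{on }\mathsf{hGL}(\boldsymbol{\nu};\mathbb{H}),$$ where $\mathbb{H}_h^\times=\mathbb{R}^\times\cup\mathrm i\mathbb{R}^\times\cup\mathrm j\mathbb{R}^\times\cup\mathrm k\mathbb{R}^\times$, $\pi:\mathbb{H}_h^\times\to\mathbb{H}_h^\times/\{\pm1,\pm\mathrm i,\pm\mathrm j,\pm\mathrm k\}\simeq\mathbb{R}^\times/\{\pm1\}$ is the quotient map, and $\mathrm{Ddet}$ is the Dieudonné determinant.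
   Context: $\mathbb{H}$ is the real algebra of quaternions with the usual units $\mathrm i,\mathrm j,\mathrm k$ ($\mathrm{ij}=\mathrm k=-\mathrm{ji}$, etc.). It is graded by $\Gamma=\{0,\tilde{\mathrm i},\tilde{\mathrm j},\tilde{\mathrm k}\}\le(\mathbb{Z}_2)^3$, $\tilde{\mathrm i}=(0,1,1)$, $\tilde{\mathrm j}=(1,0,1)$, $\tilde{\mathrm k}=(1,1,0)$, with $\mathbb{H}^0=\mathbb{R}$, $\mathbb{H}^{\tilde{\mathrm i}}=\mathrm i\mathbb{R}$, $\mathbb{H}^{\tilde{\mathrm j}}=\mathrm j\mathbb{R}$, $\mathbb{H}^{\tilde{\mathrm k}}=\mathrm k\mathbb{R}$. With $\lambda(x,y)=(-1)^{x_1y_1+x_2y_2+x_3y_3}$, homogeneous quaternions satisfy $ab=\lambda(\tilde a,\tilde b)ba$, where $\tilde a$ is the degree of $a$; moreover $\lambda(x,x)=1$ on $\Gamma$. $\mathbb{H}_h^\times$ is the group of invertible homogeneous quaternions; the isomorphism $\mathbb{H}_h^\times/\{\pm1,\pm\mathrm i,\pm\mathrm j,\pm\mathrm k\}\simeq\mathbb{R}^\times/\{\pm1\}$ sends the class of $rq$ ($r\in\mathbb{R}^\times$, $q\in\{1,\mathrm i,\mathrm j,\mathrm k\}$) to the class of $r$. $\mathfrak{S}(\lambda)$ is the set of biadditive maps $\varsigma:\Gamma\times\Gamma\to\mathbb{R}^\times$ with $\lambda(x,y)\varsigma(x,y)\varsigma(y,x)^{-1}=1$ for all $x,y\in\Gamma$.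 For such $\varsigma$, $\underline{\mathbb{H}}$ is the vector space $\mathbb{H}$ with the commutative product $a\star b=\varsigma(\tilde a,\tilde b)ab$. For $\boldsymbol{\nu}\in\Gamma^n$, an $n\times n$ matrix $X$ over $\mathbb{H}$ is homogeneous of degree $x\in\Gamma$ if $X^i_{\ j}\in\mathbb{H}^{x-\nu_i+\nu_j}$ for all $i,j$; $\mathsf{hGL}(\boldsymbol{\nu};\mathbb{H})$ is the group of all invertible homogeneous matrices (of any degree). For $X$ homogeneous of degree $x$, $J_\varsigma(X)$ is the matrix over $\underline{\mathbb{H}}$ with entries $\varsigma(x,\nu_j)\varsigma(\nu_i,x-\nu_i+\nu_j)^{-1}X^i_{\ j}$, and $\Gamma\!\det_\varsigma(X)=\det_{\underline{\mathbb{H}}}(J_\varsigma(X))$. $\mathrm{Ddet}:\mathsf{GL}(n;\mathbb{H})\to\mathbb{R}^\times/\{\pm1\}$ is the Dieudonné determinant: the unique group morphism with $\mathrm{Ddet}(\mathrm{diag}(1,\dots,1,a))=a\cdot\{\pm1\}$ for all $a\in\mathbb{R}^\times$. *)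

(* Defs.v *)
From HB Require Import structures.
From mathcomp Require Import all_boot all_order all_algebra ring.
From mathcomp Require Import classical_sets reals.

Set Implicit Arguments.
Unset Strict Implicit.
Unset Printing Implicit Defensive.

Import Order.TTheory GRing.Theory Num.Theory.
Local Open Scope ring_scope.

(* [Quat a b c d] is a + b i + c j + d k. *)

Record quat (R : Type) := Quat { qre : R; qim_i : R; qim_j : R; qim_k : R }.

Section QuatTuple.
Variable R : Type.
Definition tuple_of_quat (q : quat R) := (qre q, qim_i q, qim_j q, qim_k q).
Definition quat_of_tuple (t : R * R * R * R) :=
  let: (a, b, c, d) := t in Quat a b c d.
Lemma tuple_of_quatK : cancel tuple_of_quat quat_of_tuple.
Proof. by case. Qed.
End QuatTuple.

HB.instance Definition _ (R : eqType) :=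
  Equality.copy (quat R) (can_type (@tuple_of_quatK R)).
HB.instance Definition _ (R : choiceType) :=
  Choice.copy (quat R) (can_type (@tuple_of_quatK R)).

Section QuatRing.
Variable R : comNzRingType.
Implicit Types a b c : quat R.

Definition addq a b := Quat (qre a + qre b) (qim_i a + qim_i b)
  (qim_j a + qim_j b) (qim_k a + qim_k b).
Definition oppq a := Quat (- qre a) (- qim_i a) (- qim_j a) (- qim_k a).
Definition mulq a b := Quat
  (qre a * qre b - qim_i a * qim_i b - qim_j a * qim_j b - qim_k a * qim_k b)
  (qre a * qim_i b + qim_i a * qre b + qim_j a * qim_k b - qim_k a * qim_j b)
  (qre a * qim_j b + qim_j a * qre b + qim_k a * qim_i b - qim_i a * qim_k b)
  (qre a * qim_k b + qim_k a * qre b + qim_i a * qim_j b - qim_j a * qim_i b).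
Definition scaleq (r : R) a :=
  Quat (r * qre a) (r * qim_i a) (r * qim_j a) (r * qim_k a).

Fact addqA : associative addq.
Proof. by move=> a b c; rewrite /addq /=; congr Quat; rewrite addrA. Qed.
Fact addqC : commutative addq.
Proof. by move=> a b; rewrite /addq; congr Quat; rewrite addrC. Qed.
Fact add0q : left_id (Quat 0 0 0 0) addq.
Proof. by case=> *; rewrite /addq /= !add0r. Qed.
Fact addNq : left_inverse (Quat 0 0 0 0) oppq addq.
Proof. by case=> *; rewrite /addq /= !addNr. Qed.
HB.instance Definition _ :=
  GRing.isZmodule.Build (quat R) addqA addqC add0q addNq.

Fact mulqA : associative mulq.
Proof. by move=> a b c; rewrite /mulq /=; congr Quat; ring. Qed.
Fact mul1q : left_id (Quat 1 0 0 0) mulq.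
Proof. by case=> *; rewrite /mulq /=; congr Quat; ring. Qed.
Fact mulq1 : right_id (Quat 1 0 0 0) mulq.
Proof. by case=> *; rewrite /mulq /=; congr Quat; ring. Qed.
Fact mulqDl : left_distributive mulq +%R.
Proof. by move=> a b c; rewrite /mulq /=; congr Quat => /=; ring. Qed.
Fact mulqDr : right_distributive mulq +%R.
Proof. by move=> a b c; rewrite /mulq /=; congr Quat => /=; ring. Qed.
Fact oneq_neq0 : Quat 1 0 0 0 != 0 :> quat R.
Proof. by apply/eqP => -[] /eqP; rewrite oner_eq0. Qed.
HB.instance Definition _ := GRing.Zmodule_isNzRing.Build (quat R)
  mulqA mul1q mulq1 mulqDl mulqDr oneq_neq0.

Fact scaleqA r s a : scaleq r (scaleq s a) = scaleq (r * s) a.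
Proof. by rewrite /scaleq /= !mulrA. Qed.
Fact scale1q : left_id 1 scaleq.
Proof. by case=> *; rewrite /scaleq /= !mul1r. Qed.
Fact scaleqDr : right_distributive scaleq +%R.
Proof. by move=> r a b; rewrite /scaleq /= !mulrDr. Qed.
Fact scaleqDl a : {morph scaleq^~ a : r s / r + s}.
Proof. by move=> r s; rewrite /scaleq !mulrDl. Qed.
HB.instance Definition _ := GRing.Zmodule_isLmodule.Build R (quat R)
  scaleqA scale1q scaleqDr scaleqDl.

Fact scaleqAl r a b : r *: (a * b) = (r *: a) * b.
Proof. by congr Quat => /=; ring. Qed.
HB.instance Definition _ :=
  GRing.Lmodule_isLalgebra.Build R (quat R) scaleqAl.
Fact scaleqAr r a b : r *: (a * b) = a * (r *: b).
Proof. by congr Quat => /=; ring. Qed.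
HB.instance Definition _ :=
  GRing.Lalgebra_isAlgebra.Build R (quat R) scaleqAr.

End QuatRing.

Definition Z2cube : Type := ('Z_2 * 'Z_2 * 'Z_2)%type.
HB.instance Definition _ := GRing.Zmodule.on Z2cube.
HB.instance Definition _ := Finite.on Z2cube.

Definition ti : Z2cube := (0, 1, 1).
Definition tj : Z2cube := (1, 0, 1).
Definition tk : Z2cube := (1, 1, 0).
Definition Gamma_pred : pred Z2cube := mem [:: 0; ti; tj; tk].

Fact Gamma_zmod_closed : zmod_closed Gamma_pred.
Proof.
have GP x : x \in Gamma_pred -> [\/ x = 0, x = ti, x = tj | x = tk].
  rewrite /Gamma_pred inE !in_cons in_nil orbF => /or4P[] /eqP.
  - by constructor 1. - by constructor 2. - by constructor 3.
  - by constructor 4.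
by split=> [|x y /GP[]-> /GP[]->]; vm_compute.
Qed.
HB.instance Definition _ :=
  GRing.isZmodClosed.Build Z2cube Gamma_pred Gamma_zmod_closed.

Record Gamma := GammaOf { gval : Z2cube; _ : gval \in Gamma_pred }.
HB.instance Definition _ := [isSub for gval].
HB.instance Definition _ := [Finite of Gamma by <:].
HB.instance Definition _ := [SubChoice_isSubZmodule of Gamma by <:].

Definition gi : Gamma := GammaOf (isT : ti \in Gamma_pred).
Definition gj : Gamma := GammaOf (isT : tj \in Gamma_pred).
Definition gk : Gamma := GammaOf (isT : tk \in Gamma_pred).

Lemma GammaP (P : Gamma -> Type) : P 0 -> P gi -> P gj -> P gk -> forall x, P x.
Proof.
move=> P0 Pi Pj Pk x.
case: (eqVneq x 0) => [->//|x0]; case: (eqVneq x gi) => [->//|xi].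
case: (eqVneq x gj) => [->//|xj]; case: (eqVneq x gk) => [->//|xk].
exfalso; move: x x0 xi xj xk => [x xG]; rewrite -!val_eqE /=.
by move: xG; rewrite !inE => /or4P[] /eqP ->.
Qed.

Lemma big_Gamma (V : nmodType) (F : Gamma -> V) :
  \sum_x F x = F 0 + F gi + F gj + F gk.
Proof.
rewrite -(big_enum _ _ predT) /= (perm_big [:: 0; gi; gj; gk]).
  by rewrite !big_cons big_nil /= addr0 !addrA.
apply: uniq_perm; rewrite ?enum_uniq // => x.
by rewrite mem_enum; elim/GammaP: x.
Qed.

(* The exponent is computed in 'Z_2 and then read as 0 or 1. *)
Definition lambda (R : nzRingType) (x y : Gamma) : R :=
  let a := gval x in let b := gval y in
  (-1) ^+ (a.1.1 * b.1.1 + a.1.2 * b.1.2 + a.2 * b.2)%R.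

Section Grading.
Variable R : comNzRingType.

Definition qunit (x : Gamma) : quat R :=
  if x == gi then Quat 0 1 0 0
  else if x == gj then Quat 0 0 1 0
  else if x == gk then Quat 0 0 0 1
  else Quat 1 0 0 0.

Definition qcoord (q : quat R) (x : Gamma) : R :=
  if x == gi then qim_i q
  else if x == gj then qim_j q
  else if x == gk then qim_k q
  else qre q.

Definition qproj (x : Gamma) (q : quat R) : quat R := qcoord q x *: qunit x.

(* q belongs to the line H^x = R * qunit x. *)
Definition in_degree (x : Gamma) (q : quat R) : bool := q == qproj x q.

Lemma qproj_degree x y q :
  in_degree x q -> qproj y q = if y == x then q else 0.
Proof.
move/eqP->; elim/GammaP: x; elim/GammaP: y;
  by rewrite /qproj /qcoord /qunit /=; congr Quat => /=; ring.
Qed.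

Lemma in_degreeP x q : reflect (exists r : R, q = r *: qunit x) (in_degree x q).
Proof.
apply: (iffP eqP) => [->|[r ->]]; first by exists (qcoord q x).
elim/GammaP: x;
  by rewrite /qproj /qcoord /qunit /=; congr Quat => /=; ring.
Qed.

End Grading.

Record Slambda (R : fieldType) := MkSlambda {
  sfun :> Gamma -> Gamma -> R;
  sfun_neq0 : forall x y, sfun x y != 0;
  sfunDl : forall x y z, sfun (x + y) z = sfun x z * sfun y z;
  sfunDr : forall x y z, sfun x (y + z) = sfun x y * sfun x z;
  sfun_lambda : forall x y, lambda R x y * sfun x y * (sfun y x)^-1 = 1
}.

(* A copy of the vector space quat R, whose ring product depends on s. *)
Definition uquat (R : fieldType) (s : Slambda R) : Type := quat R.

Section Underlying.
Variables (R : fieldType) (s : Slambda R).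

HB.instance Definition _ := GRing.Lmodule.copy (uquat s) (quat R).

(* Bilinear extension of the rule on homogeneous elements. *)
Definition mulstar (a b : uquat s) : uquat s :=
  \sum_(x : Gamma) \sum_(y : Gamma) s x y *: (qproj x a * qproj y b).

Lemma mulstar_homog x y (a b : uquat s) :
    in_degree x (a : quat R) -> in_degree y (b : quat R) ->
  mulstar a b = s x y *: ((a : quat R) * (b : quat R)).
Proof.
move=> ax bY; rewrite /mulstar (bigD1 x) //= (bigD1 y) //=.
rewrite !big1 ?addr0 => [|z nz|z nz].
- by rewrite (qproj_degree _ ax) (qproj_degree _ bY) !eqxx.
- rewrite big1 // => t _.
  by rewrite (qproj_degree _ ax) (negPf nz) mul0r scaler0.
- by rewrite (qproj_degree _ bY) (negPf nz) mulr0 scaler0.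
Qed.

Lemma sfun0l x : s 0 x = 1.
Proof.
by apply: (mulfI (sfun_neq0 s 0 x)); rewrite -sfunDl addr0 mulr1.
Qed.
Lemma sfun0r x : s x 0 = 1.
Proof.
by apply: (mulfI (sfun_neq0 s x 0)); rewrite -sfunDr addr0 mulr1.
Qed.

Lemma Gamma_addxx (x : Gamma) : x + x = 0.
Proof. by apply/eqP; elim/GammaP: x. Qed.
Lemma gkE : gk = gi + gj. Proof. exact/eqP. Qed.

Lemma sfun_sqr x y : s x y * s x y = 1.
Proof. by rewrite -sfunDl Gamma_addxx sfun0l. Qed.
Lemma sfunC x y : s y x = lambda R x y * s x y.
Proof.
have := sfun_lambda s x y; move/(congr1 (fun t => t * s y x)).
by rewrite mul1r mulfVK ?sfun_neq0.
Qed.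

Lemma mulstarE (a b : uquat s) :
  let: A := s gi gi in let: B := s gj gj in let: C := s gi gj in
  mulstar a b = Quat
  (qre a * qre b - A * qim_i a * qim_i b - B * qim_j a * qim_j b
     + A * B * qim_k a * qim_k b)
  (qre a * qim_i b + qim_i a * qre b
     - B * C * (qim_j a * qim_k b + qim_k a * qim_j b))
  (qre a * qim_j b + qim_j a * qre b
     - A * C * (qim_k a * qim_i b + qim_i a * qim_k b))
  (qre a * qim_k b + qim_k a * qre b
     + C * (qim_i a * qim_j b + qim_j a * qim_i b)).
Proof.
have sji : s gj gi = - s gi gj by rewrite (sfunC gi gj) mulN1r.
have := sfun_sqr gi gj.
rewrite /mulstar !big_Gamma !sfun0l !sfun0r gkE !sfunDl !sfunDr -gkE sji.
rewrite /qproj /qcoord /qunit /=; set A := s gi gi; set B := s gj gj.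
set C := s gi gj => CC.
have CC2 : C * - C = - 1 by rewrite mulrN CC.
case: a b => [a0 a1 a2 a3] [b0 b1 b2 b3] /=.
congr Quat => /=; ring: CC.
Qed.

Fact mulstarA : associative mulstar.
Proof.
move=> a b c; rewrite !mulstarE /=.
have := sfun_sqr gi gi; have := sfun_sqr gj gj; have := sfun_sqr gi gj.
by move=> hC hB hA; congr Quat; ring: hA hB hC.
Qed.
Fact mulstarC : commutative mulstar.
Proof. by move=> a b; rewrite !mulstarE /=; congr Quat; ring. Qed.
Fact mul1star : left_id (1 : quat R) mulstar.
Proof. by case=> *; rewrite mulstarE /=; congr Quat; ring. Qed.
Fact mulstarDl : left_distributive mulstar +%R.
Proof. by move=> a b c; rewrite !mulstarE; congr Quat => /=; ring. Qed.

HB.instance Definition _ := GRing.Zmodule_isComNzRing.Build (uquat s)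
  mulstarA mulstarC mul1star mulstarDl (@oneq_neq0 R).

End Underlying.

Section GradedDet.
Variables (R : fieldType) (n : nat).
Implicit Types (s : Slambda R) (nu : 'I_n -> Gamma) (X : 'M[quat R]_n).

Definition invertible_qmx X :=
  exists Y : 'M[quat R]_n, X *m Y = 1%:M /\ Y *m X = 1%:M.

Definition homog_mx nu (x : Gamma) X : bool :=
  [forall i, forall j, in_degree (x - nu i + nu j) (X i j)].

Definition hGL nu X := invertible_qmx X /\ exists x, homog_mx nu x X.

Definition Jmx s nu (x : Gamma) X : 'M[uquat s]_n :=
  \matrix_(i, j)
     ((s x (nu j) * (s (nu i) (x - nu i + nu j))^-1) *: (X i j : uquat s)).

(* The degree of a nonzero homogeneous matrix is unique; the value on
   non-homogeneous matrices is irrelevant. *)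
Definition mxdegree nu X : Gamma := odflt 0 [pick x | homog_mx nu x X].

Definition Gdet s nu X : quat R := \det (Jmx s nu (mxdegree nu X) X).

Definition qhom_unit (q : quat R) :=
  exists x : Gamma, exists2 r : R, r != 0 & q = r *: qunit R x.

End GradedDet.

(* The elements of R^* / {1, -1} are represented as cosets, i.e. as subsets
   {r, -r} of R with r nonzero, multiplied setwise. *)

Section DieudonneDef.
Variable R : fieldType.
Local Open Scope classical_set_scope.

Definition pmclass (r : R) : set R := [set r; - r].

Definition is_pmclass (A : set R) := exists2 r, r != 0 & A = pmclass r.

Definition mulclass (A B : set R) : set R :=
  [set r * t | r in A & t in B].

Definition Q8 : set (quat R) :=
  [set q | exists x : Gamma, q = qunit R x \/ q = - qunit R x].

(* The coset a Q8, transported along H_h^* / Q8 ~ R^* / {1, -1}: if a = r u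
   with r real and u in {1, i, j, k}, this is the class {r, -r}. *)
Definition qpi (a : quat R) : set R := [set r | exists2 q, Q8 q & a = r *: q].

Definition last_diag n (a : R) : 'M[quat R]_n :=
  diag_mx (\row_(j < n) if j.+1 == n then a%:A else 1).

(* A group morphism GL(n; H) -> R^* / {1, -1}, with the normalization that
   characterizes the Dieudonne determinant; the values of D outside GL(n; H)
   are irrelevant. *)
Definition is_Ddet n (D : 'M[quat R]_n -> set R) :=
  [/\ forall X, invertible_qmx X -> is_pmclass (D X),
      forall X Y, invertible_qmx X -> invertible_qmx Y ->
        D (X *m Y) = mulclass (D X) (D Y) &
      forall a : R, a != 0 -> D (last_diag n a) = pmclass a].

End DieudonneDef.

(* Existence: the fourth root of the absolute value of the determinant of X
   acting on H^n = R^(4n). *)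
Section DieudonneExists.
Variables (R : realType) (n : nat).
Local Open Scope classical_set_scope.

Lemma pmclassM (r t : R) : mulclass (pmclass r) (pmclass t) = pmclass (r * t).
Proof.
apply/seteqP; split=> u /=.
  by case=> a [->|->] [b [->|->] <-]; rewrite /pmclass /=
    ?mulrNN ?mulNr ?mulrN; [left | right | right | left].
case=> ->.
  by exists r; [left | exists t; [left | ]].
by exists (- r); [right | exists t; [left | rewrite mulNr]].
Qed.

Lemma pmclass_norm (r : R) : pmclass `|r| = pmclass r.
Proof.
rewrite /pmclass; case: (ger0P r) => // _.
by rewrite opprK setUC.
Qed.

(* The action of X on H^n, in real coordinates. *)
Definition qcols (V : 'M[R]_(n, 4)) : 'cV[quat R]_n :=
  \col_i Quat (V i 0) (V i 1) (V i 2%:R) (V i 3%:R).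
Definition qrows (v : 'cV[quat R]_n) : 'M[R]_(n, 4) :=
  \matrix_(i, k) nth 0 [:: qre (v i 0); qim_i (v i 0); qim_j (v i 0);
                           qim_k (v i 0)] k.
Definition qact (X : 'M[quat R]_n) V := qrows (X *m qcols V).

Lemma qrowsE v i k : qrows v i k =
  nth 0 [:: qre (v i 0); qim_i (v i 0); qim_j (v i 0); qim_k (v i 0)] k.
Proof. exact: mxE. Qed.
Lemma qcolsE V i :
  qcols V i 0 = Quat (V i 0) (V i 1) (V i 2%:R) (V i 3%:R).
Proof. exact: mxE. Qed.

Lemma qrowsK : cancel qrows qcols.
Proof. by move=> v; apply/colP => i; rewrite qcolsE !qrowsE; case: (v i 0). Qed.

Lemma qcolsK : cancel qcols qrows.
Proof.
move=> V; apply/matrixP => i k; rewrite qrowsE qcolsE /=.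
by case: k => -[|[|[|[|]]]] //= k4; congr (V i _); apply/val_inj.
Qed.

Lemma nthqD (a : R) (p q : quat R) (k : 'I_4) (t := a *: p + q) :
  nth 0 [:: qre t; qim_i t; qim_j t; qim_k t] k =
  a * nth 0 [:: qre p; qim_i p; qim_j p; qim_k p] k
  + nth 0 [:: qre q; qim_i q; qim_j q; qim_k q] k.
Proof. by case: k => -[|[|[|[|]]]]. Qed.

Lemma qcolsD (a : R) U V j :
  qcols (a *: U + V) j 0 = a *: qcols U j 0 + qcols V j 0.
Proof. by rewrite !qcolsE !mxE. Qed.

Lemma linmxE (a : R) (U V : 'M[R]_(n, 4)) i k :
  (a *: U + V) i k = a * U i k + V i k.
Proof. by rewrite !mxE. Qed.

Lemma qmulE (X : 'M[quat R]_n) (v : 'cV[quat R]_n) i :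
  (X *m v) i 0 = \sum_j X i j * v j 0.
Proof. exact: mxE. Qed.

Lemma qrowsD (a : R) (u v w : 'cV[quat R]_n) i k :
  w i 0 = a *: u i 0 + v i 0 -> qrows w i k = a * qrows u i k + qrows v i k.
Proof. by move=> E; rewrite !qrowsE E nthqD. Qed.

Lemma qmulD (a : R) (X : 'M[quat R]_n) (u v w : 'cV[quat R]_n) i :
    (forall j, w j 0 = a *: u j 0 + v j 0) ->
  (X *m w) i 0 = a *: (X *m u) i 0 + (X *m v) i 0.
Proof.
move=> E; rewrite !qmulE scaler_sumr -big_split /=.
by apply: eq_bigr => j _; rewrite E mulrDr scalerAr.
Qed.

Fact qact_linear (X : 'M[quat R]_n) : linear (qact X).
Proof.
move=> a U V; apply/matrixP => i k; rewrite (linmxE a (qact X U) (qact X V)).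
apply: qrowsD; apply: qmulD => j; exact: qcolsD.
Qed.
HB.instance Definition _ X :=
  GRing.isLinear.Build R 'M[R]_(n, 4) 'M[R]_(n, 4) _ (qact X) (qact_linear X).

Definition realdet X : R := \det (lin_mx (qact X)).

Lemma realdetM X Y : realdet (X *m Y) = realdet X * realdet Y.
Proof.
rewrite /realdet mulrC -det_mulmx; congr (\det _).
apply/row_matrixP => i; rewrite !rowE mulmxA.
move: (delta_mx 0 i) => v; rewrite -[v]vec_mxK; move: (vec_mx v) => {v} V.
apply: etrans (mul_vec_lin (qact (X *m Y)) V) _.
have E : qact (X *m Y) V = qact X (qact Y V).
  by rewrite /qact qrowsK mulmxA.
apply: etrans (congr1 mxvec E) _.
apply: etrans (esym (mul_vec_lin (qact X) (qact Y V))) _.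
by congr (_ *m _); exact: esym (mul_vec_lin (qact Y) V).
Qed.

Lemma qact_last_diag (a : R) V i k :
  qact (last_diag n a) V i k = (if i.+1 == n then a else 1) * V i k.
Proof.
have E : (last_diag n a *m qcols V) i 0
    = (if i.+1 == n then a else 1) *: qcols V i 0.
  rewrite /last_diag mul_diag_mx mxE [X in X * _]mxE.
  by case: ifP => _; rewrite ?scale1r ?mul1r // -scalerAl mul1r.
rewrite -[in RHS](qcolsK V) /qact !qrowsE E.
by case: k => -[|[|[|[|]]]].
Qed.

Lemma realdet_last_diag (a : R) :
  (0 < n)%N -> realdet (last_diag n a) = a ^+ 4.
Proof.
move=> n0; rewrite /realdet.
pose d : 'M[R]_(n, 4) := \matrix_(i, k) if i.+1 == n then a else 1.
have -> : lin_mx (qact (last_diag n a)) = diag_mx (mxvec d).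
  apply/row_matrixP => r; rewrite !rowE.
  move: (delta_mx 0 r) => v; rewrite -[v]vec_mxK; move: (vec_mx v) => {v} V.
  rewrite (mul_vec_lin (qact (last_diag n a))).
  apply/rowP => l; case/mxvec_indexP: l => i k.
  by rewrite mul_mx_diag mxE !mxvecE qact_last_diag mxE mulrC.
rewrite det_diag (reindex _ (curry_mxvec_bij _ _)) /=.
rewrite (eq_bigr (fun p => d p.1 p.2)) => [|[i k] _]; last exact: mxvecE.
rewrite -(pair_bigA _ (fun i k => d i k)) /=.
have nn : (n.-1 < n)%N by rewrite prednK.
rewrite (bigD1 (Ordinal nn)) //= [X in _ * X]big1 ?mulr1 => [|i ni].
  rewrite (eq_bigr (fun=> a)) ?prodr_const ?card_ord // => k _.
  by rewrite mxE /= prednK // eqxx.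
rewrite big1 // => k _; rewrite mxE ifN //; apply: contraNneq ni => ni.
by apply/eqP/val_inj; rewrite /= -[nat_of_ord i]/(i.+1.-1) ni.
Qed.

Lemma exists_Ddet : (0 < n)%N -> exists D : 'M[quat R]_n -> set R, is_Ddet D.
Proof.
move=> n0; exists (fun X => pmclass (Num.sqrt (Num.sqrt `|realdet X|))).
have rt (a : R) : Num.sqrt (Num.sqrt `|a ^+ 4|) = `|a|.
  rewrite normrX (exprM `|a| 2 2) sqrtr_sqr normrX normr_id.
  by rewrite sqrtr_sqr normr_id.
have d1 : realdet 1%:M = 1.
  have -> : 1%:M = last_diag n (1 : R).
    rewrite /last_diag -diag_const_mx; congr diag_mx.
    by apply/rowP => j; rewrite !mxE scale1r if_same.
  by rewrite realdet_last_diag // expr1n.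
split=> [X [Y [XY _]]|X Y _ _|a _].
- exists (Num.sqrt (Num.sqrt `|realdet X|)) => //.
  rewrite gt_eqF // !sqrtr_gt0 normr_gt0.
  have /eqP := d1; rewrite -XY realdetM; apply: contraTneq => ->.
  by rewrite mul0r eq_sym oner_eq0.
- by rewrite pmclassM realdetM normrM !sqrtrM ?sqrtr_ge0.
- by rewrite realdet_last_diag // rt pmclass_norm.
Qed.

End DieudonneExists.

(* Main.v *)
(* The weights of [Jmx] form a cocycle, so J(X) J(Y) = s(x, y) J(XY), and the
   sign s(x, y)^n = s(nx, ny) is exactly the one relating the products of H and
   of its commutative deformation in degrees nx and ny: hence Gdet is
   multiplicative. The reduced norm of Gdet and the square of Ddet are then two
   real-valued multiplicative functions on hGL. Gaussian elimination stays
   inside homogeneous matrices and only uses unipotent matrices conjugate to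
   their own square, on which every such function is 1; so it suffices to
   compare the two functions on homogeneous diagonal matrices. *)

Require Import Defs.
From HB Require Import structures.
From mathcomp Require Import all_boot all_order all_fingroup all_algebra ring.
From mathcomp Require Import classical_sets reals.

Set Implicit Arguments.
Unset Strict Implicit.
Unset Printing Implicit Defensive.

Import Order.TTheory GRing.Theory Num.Theory.
Local Open Scope ring_scope.

Lemma Gamma_opp (x : Gamma) : - x = x.
Proof. exact: addr0_eq (Gamma_addxx x). Qed.

(** * Norm, conjugation and degrees of quaternions *)

Section Quaternions.
Variable R : comNzRingType.
Implicit Types (a b : quat R) (r : R) (x y : Gamma).

Definition qnormsq a : R :=
  qre a ^+ 2 + qim_i a ^+ 2 + qim_j a ^+ 2 + qim_k a ^+ 2.

Definition qconj a := Quat (qre a) (- qim_i a) (- qim_j a) (- qim_k a).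

Lemma qnormsqM a b : qnormsq (a * b) = qnormsq a * qnormsq b.
Proof. by rewrite /qnormsq /=; ring. Qed.

Lemma qnormsq1 : qnormsq 1 = 1.
Proof. by rewrite /qnormsq /=; ring. Qed.

Lemma qnormsqZ r a : qnormsq (r *: a) = r ^+ 2 * qnormsq a.
Proof. by rewrite /qnormsq /=; ring. Qed.

Lemma qnormsq_unit x : qnormsq (qunit R x) = 1.
Proof. by elim/GammaP: x; rewrite /qnormsq /qunit /=; ring. Qed.

Lemma mulq_conj a : a * qconj a = qnormsq a *: 1.
Proof. by congr Quat; rewrite /qnormsq /=; ring. Qed.

Lemma mulconj_q a : qconj a * a = qnormsq a *: 1.
Proof. by congr Quat; rewrite /qnormsq /=; ring. Qed.

Lemma qunit_sqr x : qunit R x * qunit R x = 1 \/ qunit R x * qunit R x = - 1.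
Proof.
by elim/GammaP: x; rewrite /qunit /=; [left|right|right|right];
  congr Quat => /=; ring.
Qed.

Lemma in_degreeZ r x a : in_degree x a -> in_degree x (r *: a).
Proof.
by case/in_degreeP=> t ->; apply/in_degreeP; exists (r * t); rewrite scalerA.
Qed.

Lemma in_degree0 x : in_degree x (0 : quat R).
Proof. by apply/in_degreeP; exists 0; rewrite scale0r. Qed.

Lemma in_degree1 : in_degree 0 (1 : quat R).
Proof. by apply/(in_degreeP _ _); exists 1; rewrite scale1r. Qed.

Lemma in_degree_unit x : in_degree x (qunit R x).
Proof. by apply/(in_degreeP _ _); exists 1; rewrite scale1r. Qed.

Lemma in_degreeD x a b : in_degree x a -> in_degree x b -> in_degree x (a + b).
Proof.
case/in_degreeP=> r -> /in_degreeP [t ->].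
by apply/in_degreeP; exists (r + t); rewrite scalerDl.
Qed.

Lemma in_degree_sum x (I : Type) (l : seq I) (P : pred I) (F : I -> quat R) :
  (forall i, P i -> in_degree x (F i)) -> in_degree x (\sum_(i <- l | P i) F i).
Proof.
move=> H; apply: (big_ind (in_degree x)) => //.
  exact: in_degree0.
exact: in_degreeD.
Qed.

Lemma in_degreeM x y a b :
  in_degree x a -> in_degree y b -> in_degree (x + y) (a * b).
Proof.
case/in_degreeP=> r -> /in_degreeP [t ->].
rewrite -scalerAl -scalerAr; do 2!apply: in_degreeZ.
apply/eqP; elim/GammaP: x; elim/GammaP: y;
  by rewrite /qproj /qcoord /qunit /=; congr Quat => /=; ring.
Qed.

(** Makes the inverse of a homogeneous pivot, a real multiple of its conjugate, homogeneous of the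
    same degree. *)
Lemma in_degree_conj x a : in_degree x a -> in_degree x (qconj a).
Proof.
case/in_degreeP=> r ->; apply/eqP; elim/GammaP: x;
  by rewrite /qproj /qcoord /qunit /=; congr Quat => /=; ring.
Qed.

Lemma in_degree_inj x y a : in_degree x a -> in_degree y a -> a != 0 -> x = y.
Proof.
move=> ax /eqP ay; rewrite ay (qproj_degree y ax).
by case: (eqVneq y x) => [->|_] //; rewrite eqxx.
Qed.

End Quaternions.

(** * Products in the commutative deformation of the quaternions *)

Section Underlying.
Variables (R : fieldType) (s : Slambda R).

(** As [Gamma] has exponent two, [s] only takes the values 1 and -1; this removes the inverses from
    the weights of [Jmx]. *)
Lemma sfunV x y : (s x y)^-1 = s x y.
Proof.
by apply: (mulfI (sfun_neq0 s x y)); rewrite sfun_sqr mulfV ?sfun_neq0.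
Qed.

Lemma uquat_mulE {x y : Gamma} {a b : quat R} :
    in_degree x a -> in_degree y b ->
  (a : uquat s) * (b : uquat s) = s x y *: (a * b) :> quat R.
Proof. exact: mulstar_homog. Qed.

(** Lets a scalar [r] act as an element of the ring [uquat s], the form that scaling a matrix over
    that ring requires. *)
Lemma uquat_scaleE (r : R) (a : uquat s) :
  ((r *: (1 : quat R) : quat R) : uquat s) * a = r *: a.
Proof.
by rewrite [LHS]mulstarE; congr Quat => /=; ring.
Qed.

(** The two products of homogeneous elements differ by a sign, so degrees still add up and [qnormsq]
    stays multiplicative. *)
Lemma uquat_prod (I : Type) (l : seq I) (d : I -> Gamma) (F : I -> uquat s) :
    (forall i, in_degree (d i) (F i : quat R)) ->
  in_degree (\sum_(i <- l) d i) (\prod_(i <- l) F i : quat R) /\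
  qnormsq (\prod_(i <- l) F i) = \prod_(i <- l) qnormsq (F i).
Proof.
move=> dF; elim: l => [|i l [IHd IHn]].
  by rewrite !big_nil; split; [exact: in_degree1 | exact: qnormsq1].
rewrite !big_cons; move: IHd IHn; set p := \prod_(_ <- _) F _ => IHd IHn.
rewrite (uquat_mulE (dF i) IHd); split.
  exact/in_degreeZ/in_degreeM.
by rewrite qnormsqZ qnormsqM expr2 sfun_sqr mul1r IHn.
Qed.

End Underlying.

(** * Homogeneous matrices and their degrees *)

Section Homogeneous.
Variables (R : fieldType) (n : nat) (nu : 'I_n -> Gamma).
Implicit Types (X Y : 'M[quat R]_n) (x y : Gamma).

Lemma homog_mxP x X :
  reflect (forall i j, in_degree (x - nu i + nu j) (X i j)) (homog_mx nu x X).
Proof. by apply: (iffP forallP) => H i; exact/forallP. Qed.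

Lemma homog_mx1 : homog_mx nu 0 (1%:M : 'M[quat R]_n).
Proof.
apply/homog_mxP => i j; rewrite mxE; case: eqVneq => [->|_] /=.
  by rewrite sub0r addNr; exact: in_degree1.
exact: in_degree0.
Qed.

Lemma homog_mxD x X Y :
  homog_mx nu x X -> homog_mx nu x Y -> homog_mx nu x (X + Y).
Proof.
move=> /homog_mxP Xx /homog_mxP Yx; apply/homog_mxP => i j; rewrite mxE.
exact: in_degreeD.
Qed.

Lemma homog_mxM x y X Y :
  homog_mx nu x X -> homog_mx nu y Y -> homog_mx nu (x + y) (X *m Y).
Proof.
move=> /homog_mxP Xx /homog_mxP Yy; apply/homog_mxP => i k; rewrite mxE.
apply: in_degree_sum => j _.
suff -> : x + y - nu i + nu k = x - nu i + nu j + (y - nu j + nu k).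
  exact: in_degreeM.
by rewrite [RHS]addrACA (addrACA x) !addrA subrK.
Qed.

Lemma invertible_qmxM X Y :
  invertible_qmx X -> invertible_qmx Y -> invertible_qmx (X *m Y).
Proof.
move=> [X' [XX' X'X]] [Y' [YY' Y'Y]]; exists (Y' *m X'); split.
  by rewrite mulmxA -(mulmxA X) YY' mulmx1.
by rewrite mulmxA -(mulmxA Y') X'X mulmx1.
Qed.

Lemma hGL1 : hGL nu (1%:M : 'M[quat R]_n).
Proof.
split; first by exists 1%:M; rewrite mulmx1.
by exists 0; exact: homog_mx1.
Qed.

Lemma hGLM X Y : hGL nu X -> hGL nu Y -> hGL nu (X *m Y).
Proof.
move=> [iX [x hX]] [iY [y hY]]; split; first exact: invertible_qmxM.
by exists (x + y); exact: homog_mxM.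
Qed.

Lemma invertible_col_neq0 X k : invertible_qmx X -> exists i, X i k != 0.
Proof.
case=> Y [_ YX]; apply/existsP; apply/contraT.
rewrite negb_exists => /forallP X0.
have := congr1 (fun M : 'M_n => M k k) YX; rewrite !mxE eqxx big1 => [/eqP|i _].
  by rewrite eq_sym oner_eq0.
by have := X0 i; rewrite negbK => /eqP ->; rewrite mulr0.
Qed.

(** For [n > 0], column 0 of an invertible matrix has a nonzero entry, and the degree of that entry
    determines [x]. *)
Lemma mxdegreeE X x : (0 < n)%N -> invertible_qmx X -> homog_mx nu x X ->
  mxdegree nu X = x.
Proof.
move=> n0 iX hX; rewrite /mxdegree; case: pickP => [y hY|/(_ x)]; last first.
  by rewrite hX.
have [i Xi] := invertible_col_neq0 (Ordinal n0) iX.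
have := in_degree_inj (homog_mxP _ _ hX i (Ordinal n0))
  (homog_mxP _ _ hY i (Ordinal n0)) Xi.
by move/addIr/addIr.
Qed.

(** * The graded determinant *)

Section Determinant.
Variable s : Slambda R.

Lemma JmxE x X i j :
  Jmx s nu x X i j = (s x (nu j) * s (nu i) (x - nu i + nu j)) *: (X i j).
Proof. by rewrite mxE sfunV. Qed.

Lemma JmxM x y X Y : homog_mx nu x X -> homog_mx nu y Y ->
  Jmx s nu x X *m Jmx s nu y Y
    = ((s x y *: (1 : quat R) : quat R) : uquat s) *: Jmx s nu (x + y) (X *m Y).
Proof.
move=> /homog_mxP Xx /homog_mxP Yy; apply/matrixP => i k.
rewrite [LHS]mxE [RHS]mxE uquat_scaleE JmxE scalerA mxE.
rewrite (scaler_sumr (V := quat R)); apply: eq_bigr => j _.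
rewrite !JmxE (uquat_mulE s (in_degreeZ _ (Xx i j)) (in_degreeZ _ (Yy j k))).
rewrite -scalerAl -scalerAr !scalerA; congr (_ *: _).
(* After biadditive expansion each factor involving [nu j] occurs exactly twice and its square is 1,
   so the sign no longer depends on the summation index [j]. *)
rewrite !sfunDl !sfunDr !Gamma_opp.
have := (sfun_sqr s (nu j) (nu j), sfun_sqr s (nu j) (nu k)).
have := (sfun_sqr s x (nu j), sfun_sqr s (nu i) (nu j), sfun_sqr s (nu j) y).
move=> [[h1 h2] h3] [h4 h5].
ring: h1 h2 h3 h4 h5.
Qed.

(** Each term of the Leibniz expansion has as degree the sum of the [x - nu i + nu (sg i)], where
    the contributions of [nu] cancel because [sg] only permutes them. *)
Lemma Jmx_det_degree x X :
  homog_mx nu x X -> in_degree (x *+ n) (\det (Jmx s nu x X) : quat R).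
Proof.
move=> /homog_mxP Xx; apply: in_degree_sum => sg _.
rewrite mulr_sign.
have [|+ _] := uquat_prod (s := s) (index_enum 'I_n)
  (d := fun i => x - nu i + nu (sg i))
  (F := fun i => Jmx s nu x X i (sg i)).
  by move=> i; rewrite JmxE; exact: in_degreeZ.
rewrite !big_split /= sumr_const card_ord sumrN.
have -> : \sum_i nu (sg i) = \sum_i nu i.
  by rewrite [RHS](reindex_inj (@perm_inj _ sg)).
rewrite subrK => H.
by case: ifP => // _; rewrite -scaleN1r; exact: in_degreeZ.
Qed.

Lemma GdetE x X : (0 < n)%N -> invertible_qmx X -> homog_mx nu x X ->
  Gdet s nu X = \det (Jmx s nu x X).
Proof. by move=> n0 iX hX; rewrite /Gdet (mxdegreeE n0 iX hX). Qed.

(** Biadditivity gives the exponent [n ^ 2], of the same parity as [n], and the values of [s] square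
    to 1; the proof replaces [n] by its parity. *)
Lemma sfun_pow x y : s (x *+ n) (y *+ n) = s x y ^+ n.
Proof.
have e (z : Gamma) : z *+ n = z *+ odd n.
  rewrite -[in LHS](odd_double_half n) mulrnDr -mul2n mulrnA mulr2n.
  by rewrite Gamma_addxx mul0rn addr0.
have -> : s x y ^+ n = s x y ^+ odd n.
  rewrite -[in LHS](odd_double_half n) exprD -mul2n exprM expr2.
  by rewrite sfun_sqr expr1n mulr1.
by rewrite !e; case: (odd n); rewrite ?mulr1n ?mulr0n ?expr1 // sfun0l.
Qed.

Lemma GdetM X Y : (0 < n)%N -> hGL nu X -> hGL nu Y ->
  Gdet s nu (X *m Y) = Gdet s nu X * Gdet s nu Y.
Proof.
move=> n0 [iX [x hX]] [iY [y hY]].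
rewrite (GdetE n0 iX hX) (GdetE n0 iY hY).
rewrite (GdetE n0 (invertible_qmxM iX iY) (homog_mxM hX hY)).
have := congr1 determinant (JmxM hX hY); rewrite det_mulmx detZ.
rewrite (uquat_mulE s (Jmx_det_degree hX) (Jmx_det_degree hY)).
(* [detZ] raises the scalar to the power [n] for the deformed product; on scalar multiples of 1 such
   powers agree with those in [R]. *)
have scalX (r : R) k : ((r *: (1 : quat R) : quat R) : uquat s) ^+ k
    = (r ^+ k *: (1 : quat R) : quat R).
  elim: k => [|k IH]; first by rewrite !expr0 scale1r.
  by rewrite !exprS IH uquat_scaleE scalerA.
rewrite scalX uquat_scaleE sfun_pow => /(congr1 ( *:%R (s x y ^+ n))).
by rewrite !scalerA -exprMn sfun_sqr expr1n !scale1r.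
Qed.

Lemma Gdet1 : (0 < n)%N -> Gdet s nu 1%:M = 1.
Proof.
move=> n0; have [i1 _] := hGL1; rewrite (GdetE n0 i1 homog_mx1).
suff -> : Jmx s nu 0 1%:M = 1%:M by exact: (@det1 (uquat s) n).
apply/matrixP => i j; rewrite JmxE !mxE; case: eqVneq => [->|_] /=.
  by rewrite sub0r addNr sfun0l sfun0r mul1r scale1r.
by rewrite mulr0n scaler0.
Qed.

(** The weights of [Jmx] and the deformed product only contribute signs, which [qnormsq] ignores. *)
Lemma qnormsq_Gdet_diag X : (0 < n)%N -> hGL nu X -> is_diag_mx X ->
  qnormsq (Gdet s nu X) = \prod_i qnormsq (X i i).
Proof.
move=> n0 [iX [x hX]] dX; rewrite (GdetE n0 iX hX).
have -> : Jmx s nu x X = diag_mx (\row_i Jmx s nu x X i i).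
  apply/matrixP => i j; rewrite [RHS]mxE [X in X *+ _]mxE.
  case: (eqVneq i j) => [<-|nij]; first by rewrite mulr1n.
  by rewrite mulr0n JmxE (is_diag_mxP dX) ?scaler0.
rewrite det_diag.
rewrite (eq_bigr (fun i => Jmx s nu x X i i)) => [|i _]; last first.
  by rewrite mxE.
have [i|_ ->] := uquat_prod (s := s) (index_enum 'I_n)
  (d := fun i => x - nu i + nu i)
  (F := fun i => Jmx s nu x X i i).
  by rewrite JmxE; apply: in_degreeZ; exact: homog_mxP.
apply: eq_bigr => i _; rewrite JmxE qnormsqZ -[RHS]mul1r; congr (_ * _).
by rewrite exprMn !expr2 !sfun_sqr mulr1.
Qed.

End Determinant.
End Homogeneous.

(** * Multiplicative functions on homogeneous matrices *)

Section Elimination.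
Variables (R : fieldType) (n : nat) (nu : 'I_n -> Gamma).
Hypothesis two_neq0 : 2%:R != 0 :> R.
Implicit Types (X Y N : 'M[quat R]_n) (f : 'M[quat R]_n -> R).

Definition hGL_morph f := f 1%:M = 1 /\
  forall X Y, hGL nu X -> hGL nu Y -> f (X *m Y) = f X * f Y.

Lemma hGL_morph_neq0 f X Y : hGL_morph f -> hGL nu X -> hGL nu Y ->
  X *m Y = 1%:M -> f X != 0.
Proof.
move=> [f1 fM] hX hY XY; apply: contra_eq_neq (fM X Y hX hY) => ->.
by rewrite XY f1 mul0r oner_eq0.
Qed.

Definition diag1 (k : 'I_n) (q : quat R) : 'M[quat R]_n :=
  diag_mx (\row_j if j == k then q else 1).

Lemma diag1M k p q : diag1 k p *m diag1 k q = diag1 k (p * q).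
Proof.
rewrite /diag1 mulmx_diag; congr diag_mx; apply/rowP => j; rewrite !mxE.
by case: ifP; rewrite ?mulr1.
Qed.

Lemma diag1_1 k : diag1 k 1 = 1%:M.
Proof.
rewrite /diag1 -diag_const_mx; congr diag_mx; apply/rowP => j.
by rewrite !mxE if_same.
Qed.

Lemma invertible_diag1 k p q : p * q = 1 -> q * p = 1 ->
  invertible_qmx (diag1 k p).
Proof. by move=> pq qp; exists (diag1 k q); rewrite !diag1M pq qp diag1_1. Qed.

Lemma hGL_diag1 k (a : R) : a != 0 -> hGL nu (diag1 k a%:A).
Proof.
move=> a0; split.
  apply: (@invertible_diag1 k _ a^-1%:A);
    by rewrite -scalerAl mul1r scalerA ?mulfV ?mulVf // scale1r.
exists 0; apply/homog_mxP => i j; rewrite !mxE.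
case: (eqVneq i j) => [->|_]; last by rewrite mulr0n; exact: in_degree0.
rewrite mulr1n sub0r addNr; case: ifP => _; last exact: in_degree1.
by apply: in_degreeZ; exact: in_degree1.
Qed.

Lemma hGL_unipotent N : N *m N = 0 -> homog_mx nu 0 N -> hGL nu (1%:M + N).
Proof.
move=> NN hN; split; last by exists 0; exact: homog_mxD (homog_mx1 _ _) hN.
exists (1%:M - N); split.
  by rewrite mulmxBr mulmx1 mulmxDl mul1mx NN addr0 addrK.
by rewrite mulmxBl mul1mx mulmxDr mulmx1 NN addr0 addrK.
Qed.

(* [1 + N] is conjugate to its own square by a real diagonal matrix. *)
Lemma hGL_morph_unipotent f N k : hGL_morph f -> N *m N = 0 ->
    homog_mx nu 0 N ->
    (let T := diag1 k 2%:R%:A in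
     T *m N = N /\ N *m T = N + N \/ T *m N = N + N /\ N *m T = N) ->
  f (1%:M + N) = 1.
Proof.
move=> fm NN hN /=; have n2 := two_neq0.
have hT := hGL_diag1 k n2; have hT' := hGL_diag1 k (invr_neq0 n2).
move: hT hT'; set T := diag1 k _; set T' := diag1 k _ => hT hT' H.
have TT' : T *m T' = 1%:M.
  by rewrite diag1M -scalerAl mul1r scalerA mulfV // scale1r diag1_1.
have hA := hGL_unipotent NN hN.
have hA' : hGL nu (1%:M - N).
  apply: hGL_unipotent; first by rewrite mulmxN mulNmx opprK.
  apply/homog_mxP => i j; rewrite mxE -scaleN1r.
  by apply: in_degreeZ; exact: homog_mxP.
have AA' : (1%:M + N) *m (1%:M - N) = 1%:M.
  by rewrite mulmxBr mulmx1 mulmxDl mul1mx NN addr0 addrK.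
have fT := hGL_morph_neq0 fm hT hT' TT'.
have fA := hGL_morph_neq0 fm hA hA' AA'.
have A2 : (1%:M + N) *m (1%:M + N) = 1%:M + (N + N).
  by rewrite mulmxDr mulmx1 mulmxDl mul1mx NN addr0 addrA.
have hA2 := hGLM hA hA; case: fm => f1 fM.
(* With [A = 1 + N], the first case gives [A T = T A^2] and the second [T A = A^2 T]. Since the
   values of [f] commute, both yield this equation, and cancelling the nonzero [f T] and [f A]
   leaves [f A = 1]. *)
suff E : f (1%:M + N) * f T = f T * f (1%:M + N) * f (1%:M + N).
  by apply: (mulfI fA); apply: (mulfI fT); rewrite mulr1 mulrA -E mulrC.
case: H => -[TN NT].
  rewrite -mulrA -(fM _ _ hA hT) -(fM _ _ hA hA) -(fM _ _ hT hA2); congr (f _).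
  by rewrite A2 mulmxDl mulmxDr mulmx1 mul1mx NT mulmxDr TN.
rewrite [LHS]mulrC -mulrA [RHS]mulrC -(fM _ _ hT hA) -(fM _ _ hA hA).
rewrite -(fM _ _ hA2 hT); congr (f _).
by rewrite A2 mulmxDl mulmxDr mulmx1 mul1mx TN mulmxDl NT.
Qed.

(** When [c k = 0], left multiplication by [1%:M + colmx k c] adds [c i] times row [k] to every row
    [i] at once; [rowmx] does the same for columns by right multiplication. *)
Definition colmx (k : 'I_n) (c : 'I_n -> quat R) : 'M[quat R]_n :=
  \matrix_(i, j) if j == k then c i else 0.
Definition rowmx (k : 'I_n) (r : 'I_n -> quat R) : 'M[quat R]_n :=
  \matrix_(i, j) if i == k then r j else 0.

Lemma mul_colmx k c X i j : (colmx k c *m X) i j = c i * X k j.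
Proof.
rewrite mxE (bigD1 k) //= mxE eqxx big1 ?addr0 // => l nl.
by rewrite mxE (negPf nl) mul0r.
Qed.

Lemma mul_rowmx k r X i j : (X *m rowmx k r) i j = X i k * r j.
Proof.
rewrite mxE (bigD1 k) //= mxE eqxx big1 ?addr0 // => l nl.
by rewrite mxE (negPf nl) mulr0.
Qed.

(** Doubling coordinate [k] doubles the matrix [colmx k c] from the right and, because [c k = 0],
    fixes it from the left: this is the first alternative of [hGL_morph_unipotent]. *)
Lemma colmx_morph k c : c k = 0 ->
    (forall i, in_degree (- nu i + nu k) (c i)) ->
  hGL nu (1%:M + colmx k c) /\
  forall f, hGL_morph f -> f (1%:M + colmx k c) = 1.
Proof.
move=> ck cd; set N := colmx k c.
have NN : N *m N = 0.
  by apply/matrixP => i j; rewrite mul_colmx !mxE ck if_same mulr0.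
have hN : homog_mx nu 0 N.
  apply/homog_mxP => i j; rewrite mxE sub0r; case: eqP => [->|_] //.
  exact: in_degree0.
split=> [|f fm]; first exact: hGL_unipotent.
apply: (hGL_morph_unipotent (k := k) fm NN hN); left; split.
  apply/matrixP => i j; rewrite mul_diag_mx !mxE; case: (eqVneq i k) => [->|_].
    by rewrite ck if_same mulr0.
  by rewrite mul1r.
apply/matrixP => i j; rewrite mul_mx_diag !mxE; case: eqP => _.
  by rewrite -scalerAr mulr1 scaler_nat mulr2n.
by rewrite mul0r addr0.
Qed.

Lemma rowmx_morph k r : r k = 0 ->
    (forall j, in_degree (- nu k + nu j) (r j)) ->
  hGL nu (1%:M + rowmx k r) /\
  forall f, hGL_morph f -> f (1%:M + rowmx k r) = 1.
Proof.
move=> rk rd; set N := rowmx k r.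
have NN : N *m N = 0.
  by apply/matrixP => i j; rewrite mul_rowmx !mxE rk if_same mul0r.
have hN : homog_mx nu 0 N.
  apply/homog_mxP => i j; rewrite mxE sub0r; case: eqP => [->|_] //.
  exact: in_degree0.
split=> [|f fm]; first exact: hGL_unipotent.
apply: (hGL_morph_unipotent (k := k) fm NN hN); right; split.
  apply/matrixP => i j; rewrite mul_diag_mx !mxE; case: eqP => _.
    by rewrite -scalerAl mul1r scaler_nat mulr2n.
  by rewrite mulr0 addr0.
apply/matrixP => i j; rewrite mul_mx_diag !mxE; case: (eqVneq j k) => [->|_].
  by rewrite rk if_same mul0r.
by rewrite mulr1.
Qed.

(** Homogeneity matters: over a general field the norm form can vanish on nonzero quaternions, but
    on the line spanned by a unit it is the square of the coefficient. *)
Lemma in_degree_qnormsq_neq0 x (q : quat R) :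
  in_degree x q -> q != 0 -> qnormsq q != 0.
Proof.
case/in_degreeP=> r ->; rewrite qnormsqZ qnormsq_unit mulr1 sqrf_eq0.
by apply: contraNneq => ->; rewrite scale0r.
Qed.

(** * Gaussian elimination down to homogeneous diagonal matrices *)

Section Agreement.
Variables (f g : 'M[quat R]_n -> R).
Hypotheses (fm : hGL_morph f) (gm : hGL_morph g).
Hypothesis fg_diag : forall X, hGL nu X -> is_diag_mx X -> f X = g X.

Let cleared (k : nat) X :=
  forall i j : 'I_n, i != j -> (i < k)%N || (j < k)%N -> X i j = 0.

(** Both functions are 1 on the elementary factor, so [X] may be replaced by the modified matrix;
    the last premise also hands back its membership in [hGL]. *)
Lemma agree_colmx k c X : c k = 0 ->
    (forall i, in_degree (- nu i + nu k) (c i)) -> hGL nu X ->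
    (hGL nu ((1%:M + colmx k c) *m X) ->
      f ((1%:M + colmx k c) *m X) = g ((1%:M + colmx k c) *m X)) ->
  f X = g X.
Proof.
move=> ck cd hX; have [hA A1] := colmx_morph ck cd.
move/(_ (hGLM hA hX)).
by rewrite (proj2 fm) // (proj2 gm) // !A1 // !mul1r.
Qed.

Lemma agree_rowmx k r X : r k = 0 ->
    (forall j, in_degree (- nu k + nu j) (r j)) -> hGL nu X ->
    (hGL nu (X *m (1%:M + rowmx k r)) ->
      f (X *m (1%:M + rowmx k r)) = g (X *m (1%:M + rowmx k r))) ->
  f X = g X.
Proof.
move=> rk rd hX; have [hA A1] := rowmx_morph rk rd.
move/(_ (hGLM hX hA)).
by rewrite (proj2 fm) // (proj2 gm) // !A1 // !mulr1.
Qed.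

Lemma agree_clear (k : 'I_n) X : hGL nu X -> cleared k X -> X k k != 0 ->
    (forall Y, hGL nu Y -> cleared k.+1 Y -> f Y = g Y) ->
  f X = g X.
Proof.
move=> hX cX Xk IH; case: (hX) => iX [x /homog_mxP Xx].
(* [p] is the inverse of the pivot, again of degree [x] because [Gamma] has exponent two. *)
pose q := X k k; pose p := (qnormsq q)^-1 *: qconj q.
have qk : in_degree x q by have := Xx k k; rewrite subrK.
have nq := in_degree_qnormsq_neq0 qk Xk.
have pk : in_degree x p by apply: in_degreeZ; exact: in_degree_conj.
have pq : p * q = 1 by rewrite -scalerAl mulconj_q scalerA mulVf ?scale1r.
have qp : q * p = 1 by rewrite -scalerAr mulq_conj scalerA mulVf ?scale1r.
(* As entries do not commute, [p] stands on the right in the row operations and on the left in the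
   column operations; the 0 at [k] makes both factors unipotent. *)
pose c i := if i == k then 0 else - (X i k * p).
pose r j := if j == k then 0 else - (p * X k j).
have ck : c k = 0 by rewrite /c eqxx.
have rk : r k = 0 by rewrite /r eqxx.
apply: (agree_colmx (k := k) (c := c) ck _ hX) => [i|].
  rewrite /c; case: eqP => _; first exact: in_degree0.
  rewrite -scaleN1r; apply: in_degreeZ.
  suff -> : - nu i + nu k = x - nu i + nu k + x by exact: in_degreeM.
  by rewrite [RHS]addrC !addrA Gamma_addxx add0r.
move=> hY; apply: (agree_rowmx (k := k) (r := r) rk _ hY) => [j|].
  rewrite /r; case: eqP => _; first exact: in_degree0.
  rewrite -scaleN1r; apply: in_degreeZ.
  suff -> : - nu k + nu j = x + (x - nu k + nu j) by exact: in_degreeM.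
  by rewrite !addrA Gamma_addxx add0r.
move=> hZ; apply: IH => // {hY hZ} i j nij.
have YE a b : ((1%:M + colmx k c) *m X) a b = X a b + c a * X k b.
  by rewrite mulmxDl mul1mx mxE mul_colmx.
move=> H; rewrite mulmxDr mulmx1 mxE mul_rowmx !YE {YE}.
have [jk|njk] := eqVneq j k.
  rewrite jk rk /c -jk (negPf nij) jk mulr0 addr0.
  by rewrite mulNr -mulrA pq mulr1 addrN.
have [ik|nik] := eqVneq i k.
  by rewrite ik ck !mul0r !addr0 /r (negPf njk) mulrN mulrA qp mul1r addrN.
(* Away from row and column [k], the entry changes by [- (X i k * p * X k j)], and [cX] kills one of
   the outer factors when [i] or [j] was treated earlier. *)
have {}H : (i < k)%N || (j < k)%N.
  move: H; rewrite (ltnS i) (ltnS j) (leq_eqVlt i) (leq_eqVlt j).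
  by rewrite !(val_eqE _ k) (negPf nik) (negPf njk).
rewrite /c (negPf nik) mulNr (mulNr _ (X k k)) -mulrA -(mulrA _ p (X k k)) pq.
rewrite mulr1 addrN mul0r addr0 (cX i j) // add0r.
case/orP: H => lt; first by rewrite (cX i k) ?lt // mul0r oppr0.
by rewrite (cX k j) ?lt ?orbT ?mulr0 ?oppr0 // eq_sym.
Qed.

Lemma agree_step (k : 'I_n) X : hGL nu X -> cleared k X ->
    (forall Y, hGL nu Y -> cleared k.+1 Y -> f Y = g Y) ->
  f X = g X.
Proof.
move=> hX cX IH; case: (eqVneq (X k k) 0) => [X0|]; last first.
  by move=> Xk; exact: agree_clear IH.
have [iX _] := hX; have [i Xik] := invertible_col_neq0 k iX.
have nik : i != k by apply: contraNneq Xik => ->; rewrite X0.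
(* Rows before [k] are already cleared, so row [i] lies beyond them and has zeros in the columns
   before [k]; adding it to row [k] spoils nothing. *)
have ki : (k <= i)%N.
  by rewrite leqNgt; apply: contraNN Xik => lt; rewrite cX ?lt.
(* Swapping rows need not be homogeneous. Instead row [i] is added to row [k] with a coefficient of
   the degree that keeps the matrix homogeneous. *)
pose u := qunit R (- nu k + nu i).
pose c l := if l == k then u else 0.
apply: (agree_colmx (k := i) (c := c) _ _ hX) => [|l|hY].
- by rewrite /c (negPf nik).
- rewrite /c; case: eqP => [->|_]; last exact: in_degree0.
  exact: in_degree_unit.
have YE a b : ((1%:M + colmx i c) *m X) a b = X a b + c a * X i b.
  by rewrite mulmxDl mul1mx mxE mul_colmx.
apply: agree_clear hY _ _ IH => [a b nab lt|].
  rewrite YE (cX a b) // add0r /c; case: eqP => [ak|_]; last by rewrite mul0r.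
  move: lt; rewrite ak ltnn /= => bk; rewrite (cX i b) ?bk ?orbT ?mulr0 //.
  by apply: contraTneq bk => <-; rewrite -leqNgt.
rewrite YE X0 add0r /c eqxx; apply: contraNneq Xik => uX.
(* The new pivot is [u * X i k], where [u] cancels because it squares to 1 or -1. *)
have := qunit_sqr R (- nu k + nu i); rewrite -/u => -[] uu.
  by rewrite -[X i k]mul1r -uu -mulrA uX mulr0.
by rewrite -[X i k]opprK -[- X i k]mulN1r -uu -mulrA uX mulr0 oppr0.
Qed.

Lemma hGL_morph_ext X : hGL nu X -> f X = g X.
Proof.
(* [m] counts the pivots still to be treated; at [k = n], being cleared means being diagonal. *)
suff H m k : (k + m = n)%N -> forall Y, hGL nu Y -> cleared k Y -> f Y = g Y.
  by move=> hX; apply: (H n 0%N).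
elim: m k => [|m IH] k.
  rewrite addn0 => -> Y hY cY; apply: fg_diag => //.
  apply/is_diag_mxP => i j nij; apply: cY; last by rewrite ltn_ord.
  by apply: contraNneq nij => ->.
rewrite addnS => kmn Y hY cY; have kn : (k < n)%N.
  by rewrite -kmn ltnS leq_addr.
by apply: (@agree_step (Ordinal kn)) => // Z; apply: IH; rewrite addSn.
Qed.

End Agreement.
End Elimination.

(** * The square of the Dieudonne determinant on diagonal matrices *)

Section Dieudonne.
Variables (R : realType) (n : nat) (D : 'M[quat R]_n -> set R).
Hypothesis hD : is_Ddet D.
Implicit Types (X Y : 'M[quat R]_n) (k l : 'I_n).

(* The square of either element of the coset [D X]. *)
Definition Dsqr X : R := (xget 0 (D X)) ^+ 2.

Lemma DsqrE X r : D X = pmclass r -> Dsqr X = r ^+ 2.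
Proof.
rewrite /Dsqr => ->; have : pmclass r (xget 0 (pmclass r)).
  by apply: (@xgetI _ 0 (pmclass r) r); left.
by case=> ->; rewrite ?sqrrN.
Qed.

Lemma DsqrM X Y : invertible_qmx X -> invertible_qmx Y ->
  Dsqr (X *m Y) = Dsqr X * Dsqr Y.
Proof.
case: hD => Dcl DM _ iX iY; have [r _ Xr] := Dcl X iX.
have [t _ Yt] := Dcl Y iY; rewrite (DsqrE Xr) (DsqrE Yt) -exprMn.
by apply: DsqrE; rewrite DM // Xr Yt pmclassM.
Qed.

Lemma Dsqr_neq0 X : invertible_qmx X -> Dsqr X != 0.
Proof.
case: hD => Dcl _ _ iX; have [r r0 Xr] := Dcl X iX.
by rewrite (DsqrE Xr) sqrf_eq0.
Qed.

Lemma invertible_qmx1 : invertible_qmx (1%:M : 'M[quat R]_n).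
Proof. by exists 1%:M; rewrite mulmx1. Qed.

Lemma Dsqr1 : Dsqr 1%:M = 1.
Proof.
have i1 := invertible_qmx1; apply: (mulfI (Dsqr_neq0 i1)).
by rewrite -DsqrM // mulmx1 mulr1.
Qed.

(** Serves to reach the last diagonal place, the only one in the normalization of [D]. The
    transposition matrix need not be homogeneous, but [D] is multiplicative on all invertible
    matrices. *)
Lemma Dsqr_diag1_perm k l q : invertible_qmx (diag1 k q) ->
  invertible_qmx (diag1 l q) -> Dsqr (diag1 k q) = Dsqr (diag1 l q).
Proof.
move=> ik il; pose P : 'M[quat R]_n := perm_mx (tperm k l).
have PP : P *m P = 1%:M by rewrite -perm_mxM tperm2 perm_mx1.
have iP : invertible_qmx P by exists P.
have E : diag1 k q *m P = P *m diag1 l q.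
  rewrite /P -[in LHS](tpermV k l) -col_permE -row_permE.
  apply/matrixP => i j; rewrite !mxE -(inj_eq (@perm_inj _ (tperm k l))) tpermL.
  by rewrite -[in RHS](tpermK k l j) (inj_eq (@perm_inj _ (tperm k l))).
by apply: (mulIf (Dsqr_neq0 iP)); rewrite -DsqrM // E DsqrM // mulrC.
Qed.

Lemma invertible_diag1_homog k x (q : quat R) : in_degree x q -> q != 0 ->
  invertible_qmx (diag1 k q).
Proof.
move=> xq q0; have nq := in_degree_qnormsq_neq0 xq q0.
apply: (@invertible_diag1 _ _ k q ((qnormsq q)^-1 *: qconj q)).
  by rewrite -scalerAr mulq_conj scalerA mulVf // scale1r.
by rewrite -scalerAl mulconj_q scalerA mulVf // scale1r.
Qed.

Lemma Dsqr_diag1_real k (a : R) : a != 0 -> Dsqr (diag1 k a%:A) = a ^+ 2.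
Proof.
move=> a0; have ia l : invertible_qmx (diag1 l (a%:A : quat R)).
  apply: (@invertible_diag1_homog l 0).
    by apply: in_degreeZ; exact: in_degree1.
  by rewrite scaler_eq0 negb_or a0 oner_neq0.
have n0 : (n.-1 < n)%N by rewrite prednK // (leq_trans _ (ltn_ord k)).
rewrite (Dsqr_diag1_perm (ia k) (ia (Ordinal n0))).
have -> : diag1 (Ordinal n0) a%:A = last_diag n a.
  congr diag_mx; apply/rowP => j; rewrite !mxE -(inj_eq val_inj) /=.
  by rewrite -eqSS prednK // (leq_trans _ (ltn_ord k)).
by case: hD => _ _ /(_ a a0) /DsqrE.
Qed.

Lemma Dsqr_diag1 k x (q : quat R) : in_degree x q -> q != 0 ->
  Dsqr (diag1 k q) = qnormsq q.
Proof.
move=> /in_degreeP [r ->] q0.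
have r0 : r != 0 by apply: contraNneq q0 => ->; rewrite scale0r.
have u0 : qunit R x != 0 by apply: contraNneq q0 => ->; rewrite scaler0.
have iu := invertible_diag1_homog k (in_degree_unit R x) u0.
have ir : invertible_qmx (diag1 k (r%:A : quat R)).
  apply: (@invertible_diag1_homog k 0).
    by apply: in_degreeZ; exact: in_degree1.
  by rewrite scaler_eq0 negb_or r0 oner_neq0.
rewrite qnormsqZ qnormsq_unit mulr1.
have -> : r *: qunit R x = r%:A * qunit R x by rewrite -scalerAl mul1r.
rewrite -diag1M DsqrM // Dsqr_diag1_real //.
suff -> : Dsqr (diag1 k (qunit R x)) = 1 by rewrite mulr1.
(* [Dsqr] is nonnegative, so it is enough that its value on the unit squares to 1; the unit itself
   squares to 1 or -1, and [Dsqr] is 1 in both cases. *)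
apply/eqP; rewrite -(eqrXn2 (n := 2)) ?sqr_ge0 // expr1n expr2 -DsqrM // diag1M.
case: (qunit_sqr R x) => ->; first by rewrite diag1_1 Dsqr1.
by rewrite -scaleN1r Dsqr_diag1_real ?sqrrN ?expr1n // oppr_eq0 oner_neq0.
Qed.

(** The list [w] of places already filled allows an induction that multiplies in one diagonal entry
    at a time. *)
Lemma Dsqr_diag_seq (d : 'I_n -> quat R) (w : seq 'I_n) :
    (forall i, exists x, in_degree x (d i)) -> (forall i, d i != 0) -> uniq w ->
  let M := diag_mx (\row_j if j \in w then d j else 1) in
  invertible_qmx M /\ Dsqr M = \prod_(i <- w) qnormsq (d i).
Proof.
move=> dx d0; elim: w => [|k w IH] /=.
  have -> : \row_(j < n) (if j \in [::] then d j else 1) = const_mx 1.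
    by apply/rowP => j; rewrite !mxE.
  by rewrite diag_const_mx big_nil Dsqr1; split; first exact: invertible_qmx1.
move=> /andP[kw /IH []]; set M := diag_mx _ => iM DM.
have -> : diag_mx (\row_j if j \in k :: w then d j else 1) = diag1 k (d k) *m M.
  rewrite /diag1 mulmx_diag; congr diag_mx; apply/rowP => j.
  rewrite !mxE in_cons.
  by case: (eqVneq j k) => [->|_] /=; rewrite ?(negPf kw) ?mulr1 ?mul1r.
have [x xd] := dx k; have ik := invertible_diag1_homog k xd (d0 k).
split; first exact: invertible_qmxM.
by rewrite DsqrM // big_cons DM (Dsqr_diag1 k xd).
Qed.

Lemma Dsqr_diag (nu : 'I_n -> Gamma) X : hGL nu X -> is_diag_mx X ->
  Dsqr X = \prod_i qnormsq (X i i).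
Proof.
move=> [iX [x /homog_mxP Xx]] dX.
have dx i : exists y, in_degree y (X i i) by eexists; exact: Xx.
have d0 i : X i i != 0.
  have [j Xj] := invertible_col_neq0 i iX.
  suff ij : j = i by rewrite -{1}ij.
  by apply/val_inj/eqP; apply: contraNT Xj => ji; rewrite (is_diag_mxP dX).
have [_ <-] := Dsqr_diag_seq dx d0 (index_enum_uniq 'I_n).
congr Dsqr; apply/matrixP => i j; rewrite !mxE mem_index_enum.
case: eqVneq => [->|ij]; first by rewrite mulr1n.
by rewrite mulr0n (is_diag_mxP dX).
Qed.

End Dieudonne.

(** * Comparison of the two determinants *)

Lemma pmclass_sqr (R : realType) (r t : R) :
  r ^+ 2 = t ^+ 2 -> pmclass r = pmclass t.
Proof.
move/eqP; rewrite eqf_sqr => /orP[] /eqP -> //.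
by rewrite -pmclass_norm normrN pmclass_norm.
Qed.

(** All elements of [Q8] have norm 1, so any way of writing the quaternion as a real multiple of one
    of them gives a coefficient with square [r ^+ 2]. *)
Lemma qpi_homog (R : realType) (r : R) (x : Gamma) :
  qpi (r *: qunit R x) = pmclass r.
Proof.
apply/seteqP; split=> t /=.
  case=> q [y qy] /(congr1 (@qnormsq R)); rewrite !qnormsqZ qnormsq_unit mulr1.
  have -> : qnormsq q = 1.
    case: qy => ->; first exact: qnormsq_unit.
    by rewrite -scaleN1r qnormsqZ qnormsq_unit sqrrN expr1n mulr1.
  by rewrite mulr1 => /pmclass_sqr ->; left.
case=> ->; first by exists (qunit R x) => //; exists x; left.
by exists (- qunit R x); [exists x; right | rewrite scaleNr scalerN opprK].
Qed.

Lemma qnormsq_Gdet (R : realType) (n : nat) (s : Slambda R)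
    (nu : 'I_n -> Gamma) (D : 'M[quat R]_n -> set R) (X : 'M[quat R]_n) :
  (0 < n)%N -> is_Ddet D -> hGL nu X -> qnormsq (Gdet s nu X) = Dsqr D X.
Proof.
move=> n0 hD hX.
apply: (@hGL_morph_ext R n nu _ (fun Y => qnormsq (Gdet s nu Y)) (Dsqr D))
  => //.
- by rewrite pnatr_eq0.
- split=> [|Y Z hY hZ]; first by rewrite Gdet1 // qnormsq1.
  by rewrite GdetM // qnormsqM.
- split=> [|Y Z [iY _] [iZ _]]; first exact: Dsqr1.
  exact: DsqrM.
by move=> Y hY dY; rewrite (Dsqr_diag hD hY dY) qnormsq_Gdet_diag.
Qed.

(** The degree of the determinant puts it on a line spanned by a unit. Norms then identify its
    coefficient up to sign with an element of [D X], which also shows that it is nonzero. *)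
Lemma Gdet_hom_Ddet (R : realType) (n : nat) (s : Slambda R)
    (nu : 'I_n -> Gamma) (D : 'M[quat R]_n -> set R) (X : 'M[quat R]_n) :
    (0 < n)%N -> is_Ddet D -> hGL nu X ->
  exists x, exists2 r, r != 0 & Gdet s nu X = r *: qunit R x /\ D X = pmclass r.
Proof.
move=> n0 hD hX; have := qnormsq_Gdet s n0 hD hX.
have [iX [x hx]] := hX; have [Dcl _ _] := hD; have [t t0 Xt] := Dcl X iX.
have := Jmx_det_degree s hx; rewrite -GdetE // => /in_degreeP [r ->].
rewrite qnormsqZ qnormsq_unit mulr1 (DsqrE Xt) => rt.
exists (x *+ n), r; last by rewrite Xt (pmclass_sqr rt).
by rewrite -sqrf_eq0 rt sqrf_eq0.
Qed.

Theorem proposition6p5 (R : realType) (n : nat) (n_ge1 : (1 <= n)%N)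
    (s : Slambda R) (nu : 'I_n -> Gamma) :
  [/\ forall X : 'M[quat R]_n, hGL nu X -> qhom_unit (Gdet s nu X),
      forall X Y : 'M[quat R]_n, hGL nu X -> hGL nu Y ->
        Gdet s nu (X *m Y) = Gdet s nu X * Gdet s nu Y
    & forall D : 'M[quat R]_n -> set R, is_Ddet D ->
        forall X : 'M[quat R]_n, hGL nu X -> qpi (Gdet s nu X) = D X].
Proof.
split=> [X hX|X Y|D hD X hX]; last 2 first.
- exact: GdetM.
- by have [x [r _ [-> ->]]] := Gdet_hom_Ddet s n_ge1 hD hX; exact: qpi_homog.
(* Invertibility of the graded determinant is also read off a Dieudonne determinant, so one has to
   exist. *)
have [D hD] := exists_Ddet R n_ge1.
by have [x [r r0 [-> _]]] := Gdet_hom_Ddet s n_ge1 hD hX; exists x, r.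
Qed.
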